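(* Let $(X,d,\nu)$ be a metric measure space with $\nu(X)=+\infty$, and let $s>0$. Assume that $\nu$ is Ahlfors regular, namely there exist constants $C_a,C_A>0$ such that $$C_a r^s\le\nu(B(x,r))\le C_A r^s\qquad\text{for all }x\in X,\ r>0 .$$ Then for all $p\in[1,\infty)$ and all $u\in L^p(X,\nu)$, $$c_1\|u\|_{L^p(X,\nu)}^p\le \bigg[\frac{u(x)-u(y)}{d(x,y)^{\frac sp}}\bigg]^p_{L^p_w(X\times X,\nu\otimes\nu)}\le c_2\|u\|_{L^p(X,\nu)}^p$$ with $c_1=2C_a$ and $c_2=2^{p+1}C_A$. Furthermore, setting $$E_\lambda=\bigg\{(x,y)\in X\times X:\ \frac{|u(x)-u(y)|}{d(x,y)^{\frac sp}}\ge\lambda\bigg\}\qquad(\lambda>0),$$ one has $$2C_a\|u\|_{L^p(X,\nu)}^p\le\liminf_{\lambda\to0^+}\lambda^p(\nu\otimes\nu)(E_\lambda)\le\limsup_{\lambda\to0^+}\lambda^p(\nu\otimes\nu)(E_\lambda)\le 2C_A\|u\|_{L^p(X,\nu)}^p .$$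
   Context: A metric measure space is a triple $(X,d,\nu)$, where $(X,d)$ is a complete and separable metric space and $\nu$ is a nonzero non-negative Borel measure on $X$ that is finite on bounded sets. $B(x,r)=\{y\in X: d(x,y)<r\}$ is the ball with center $x$ and radius $r>0$. Functions $u$ are real-valued. For a measure space $(Z,\mu)$, $p\ge 1$ and a $\mu$-measurable function $g:Z\to\mathbb{R}$, the weak-$L^p$ (Marcinkiewicz) quantity, raised to the power $p$, is $$[g]^p_{L^p_w(Z,\mu)}=\sup_{\lambda>0}\lambda^p\,\mu(\{z\in Z:\ |g(z)|\ge\lambda\}).$$ Here it is used with $Z=X\times X$ and $\mu=\nu\otimes\nu$. Difference quotients are taken to be $0$ on the diagonal $\{x=y\}$. *)

(* Defs.v *)
From HB Require Import structures.
From mathcomp Require Import all_boot all_order all_algebra.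
From mathcomp Require Import all_classical all_reals all_analysis.

Set Implicit Arguments.
Unset Strict Implicit.
Unset Printing Implicit Defensive.

Import Order.TTheory GRing.Theory Num.Theory.
Import numFieldNormedType.Exports.

Local Open Scope classical_set_scope.
Local Open Scope ring_scope.

(* Library complete spaces and measurable types are pointed; this is harmless
   here, since a space carrying a nonzero measure is nonempty. *)
#[short(type="completeMetricType")]
HB.structure Definition CompleteMetric (R : numDomainType) :=
  {T of Complete T & Metric R T}.

Definition separable (T : topologicalType) : Prop :=
  exists2 D : set T, countable D & dense D.

Definition borelType (T : ptopologicalType) := g_sigma_algebraType (@open T).

Section metric_measure_space.
Context {R : realType} (X : completeMetricType R).
Local Open Scope ereal_scope.

Definition finite_on_bounded (nu : set X -> \bar R) : Prop :=
  forall A : set (borelType X), measurable A ->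
    (exists (x : X) (r : R), A `<=` ball x r) -> nu A < +oo.

Definition metric_measure_space
    (nu : {measure set (borelType X) -> \bar R}) : Prop :=
  [/\ separable X, nu [set: X] != 0 & finite_on_bounded nu].

Definition ahlfors_regular (nu : set X -> \bar R) (s Ca CA : R) : Prop :=
  forall (x : X) (r : R), (0 < r)%R ->
    (Ca * r `^ s)%:E <= nu (ball x r) <= (CA * r `^ s)%:E.

End metric_measure_space.

(* the weak-L^p quantity already raised to the power p *)
Definition weak_Lp_pow {d} {Z : measurableType d} {R : realType}
    (mu : set Z -> \bar R) (p : R) (g : Z -> R) : \bar R :=
  ereal_sup
    [set ((l `^ p)%:E * mu [set z | (l <= `|g z|)%R])%E | l in [set l | 0 < l]].

Section difference_quotient.
Context {R : realType} (X : completeMetricType R).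

Definition diff_quot (u : X -> R) (a : R) (z : X * X) : R :=
  (u z.1 - u z.2) / mdist z.1 z.2 `^ a.

Lemma diff_quot_diag (u : X -> R) (a : R) (x : X) : diff_quot u a (x, x) = 0.
Proof. by rewrite /diff_quot subrr mul0r. Qed.

Definition diff_quot_superlevel (u : X -> R) (a l : R) : set (X * X) :=
  [set z | l <= `|u z.1 - u z.2| / mdist z.1 z.2 `^ a].

End difference_quotient.

(* Main.v *)
Require Import Defs.
From HB Require Import structures.
From mathcomp Require Import all_boot all_order all_algebra.
From mathcomp Require Import all_classical all_reals all_analysis.
From mathcomp Require Import measurable_realfun.
From mathcomp Require Import ring lra.
Import Order.TTheory GRing.Theory Num.Theory.
Import numFieldNormedType.Exports.
Local Open Scope classical_set_scope.
Local Open Scope ring_scope.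
Local Open Scope ereal_scope.

(* Write [A t] for the set of pairs with [t d(x,y)^(s/p) <= |u x|], and [B t]
   for its mirror image. The section of [A t] at [x] is the closed ball of
   radius [(|u x| / t)^(p/s)], so by Ahlfors regularity and Tonelli
   [t^p (nu x nu)(A t)] lies between [Ca ||u||^p] and [CA ||u||^p] for every
   [t]. The intersection is negligible at small levels:
   [t^p (nu x nu)(A t `&` B t) --> 0] as [t --> 0], because the points where
   [|u| < eta] contribute at most [2 CA] times the integral of [|u|^p] over
   them, and the others form a set of finite measure. The bounds follow from
   the triangle inequality for real numbers, which sandwiches the superlevel
   set [E_l] between [A ((1+e)l) `\` B (el)] together with its mirror image and
   [A (cl) `|` B (cl) `|` (A ((1-c)l) `&` B ((1-c)l))], with [e --> 0] and
   [c --> 1]; for [c = 1/2] the last intersection is redundant. *)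

(** * Limits inferior and superior along a filter *)

Section limf.
Context {R : realType} {T : choiceType} {X : filteredType T}.
Implicit Types (f : X -> \bar R) (F : set_system X) (M : \bar R).

Lemma limf_esup_le_near f F M :
  (\forall x \near F, f x <= M) -> limf_esup f F <= M.
Proof.
move=> fM; rewrite limf_esupE; apply: ge_ereal_inf.
exists (ereal_sup (f @` [set x | f x <= M])).
  by exists [set x | f x <= M].
by apply: ge_ereal_sup => _ [x /= fxM <-].
Qed.

Lemma limf_einf_ge_near f F M :
  (\forall x \near F, M <= f x) -> M <= limf_einf f F.
Proof.
move=> fM; rewrite limf_einfE; apply: le_ereal_sup_tmp.
exists (ereal_inf (f @` [set x | M <= f x])).
  by exists [set x | M <= f x].
by apply: le_ereal_inf_tmp => _ [x /= fxM <-].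
Qed.

(** Any two members of a proper filter share a point, and the value of [f] there separates the
    infimum over one from the supremum over the other. *)
Lemma limf_einf_le_esup f F (FF : ProperFilter F) :
  limf_einf f F <= limf_esup f F.
Proof.
rewrite limf_einfE limf_esupE; apply: ge_ereal_sup => _ [V FV <-].
apply: le_ereal_inf_tmp => _ [W FW <-].
have FVW : F (V `&` W) by exact: filterI.
have [x [Vx Wx]] := filter_ex FVW.
by apply: (@le_trans _ _ (f x));
  [apply: ereal_inf_lbound|apply: ereal_sup_ubound]; exists x.
Qed.

End limf.

(** * Symmetry of the product measure *)

Section product_measure_swap.
Context d (T : measurableType d) (R : realType).
Variable nu : {sigma_finite_measure set T -> \bar R}.

(** The x-sections of the mirror image are the y-sections of [A], so the left-hand side is the
    iterated integral in the other order. Both orders agree on rectangles, hence everywhere by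
    uniqueness of the product measure. *)
Lemma product_measure_swap (A : set (T * T)) : measurable A ->
  (nu \x nu) ([set z | A (z.2, z.1)]) = (nu \x nu) A.
Proof.
move=> mA; transitivity ((nu \x^ nu) A); first by apply: eq_integral.
symmetry; apply: product_measure_unique => // B C mB mC.
exact: product_measure2E.
Qed.

End product_measure_swap.

(** * Borel measurability of balls and of the distance *)

Section metric_borel.
Context {R : realType} (X : completeMetricType R).

Lemma metric_ball_open (x : X) (r : R) : open (ball x r).
Proof.
rewrite openE => y; rewrite ballEmdist /= => xy.
apply/nbhs_ballP; exists (r - mdist x y)%R; first by rewrite /= subr_gt0.
move=> z; rewrite !ballEmdist /= => yz.
by rewrite (le_lt_trans (metric_triangle _ y _))// -ltrBrDl.
Qed.

Lemma measurable_metric_ball (x : X) (r : R) :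
  measurable (ball x r : set (borelType X)).
Proof. by apply: sub_sigma_algebra; exact: metric_ball_open. Qed.

Lemma measurable_closed_mdist_ball (x : X) (r : R) :
  measurable ([set y | mdist x y <= r]%R : set (borelType X)).
Proof.
have -> : [set y | mdist x y <= r]%R =
    \bigcap_n ball x (r + n.+1%:R^-1)%R.
  apply/seteqP; split => [y /= xyr n _|y /= xyr].
    by rewrite ballEmdist /= (le_lt_trans xyr)// ltrDl invr_gt0.
  rewrite leNgt; apply/negP => rxy.
  have e0 : (0 < mdist x y - r)%R by rewrite subr_gt0.
  have [n _ /(_ _ (leqnn n)) /= nr] := near_infty_natSinv_lt (PosNum e0).
  have := xyr n I; rewrite ballEmdist /= => h.
  move: nr; rewrite ltrBrDl => nr; have := lt_trans h nr.
  by rewrite ltxx.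
by apply: bigcapT_measurable => n; exact: measurable_metric_ball.
Qed.

Hypothesis sepX : separable X.

(** Continuity alone does not suffice: the pairs carry the product of the Borel sigma-algebras,
    which need not contain every open set of the product. Separability makes [{d < r}] a countable
    union of rectangles of balls centred in [D]. *)
Lemma measurable_mdist :
  measurable_fun [set: borelType X * borelType X]
    (fun z : borelType X * borelType X => mdist (z.1 : X) (z.2 : X) : R).
Proof.
have [D cD dD] := sepX.
apply: (measurability _ (RGenInftyO.measurableE R)) => //=.
move=> _ [_ [r ->] <-]; rewrite setTI.
pose B n (i : X) : set (borelType X * borelType X) :=
  ball i n.+1%:R^-1%R `*` ball i (r - n.+1%:R^-1)%R.
rewrite (_ : _ @^-1` _ = \bigcup_n \bigcup_(i in D) B n i).
  apply: bigcupT_measurable => n; rewrite bigcup_set_type.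
  apply: countable_bigcupT_measurable => [|i].
    by rewrite (eq_countable (card_setT _)).
  by apply: measurableX; exact: measurable_metric_ball.
apply/seteqP; split => [[x y] /=|[x y] [n _ [i _ []]]]; last first.
  rewrite !ballEmdist /= in_itv /= => ix iy.
  rewrite (le_lt_trans (metric_triangle _ i _))// metric_sym.
  by rewrite (lt_le_trans (ltrD ix iy))// addrC subrK.
rewrite in_itv /= => xyr.
have e0 : (0 < (r - mdist x y) / 2)%R by rewrite divr_gt0// subr_gt0.
have [n _ /(_ _ (leqnn n)) /= ne] := near_infty_natSinv_lt (PosNum e0).
have n0 : (0 < n.+1%:R^-1 :> R)%R by rewrite invr_gt0.
(* With [1/(n+1) < (r - d(x,y))/2], a centre [i] this close to [x] satisfies
   [d(i,y) < d(x,y) + 1/(n+1) < r - 1/(n+1)]. *)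
have [i [Di xi]] : D `&` ball x n.+1%:R^-1%R !=set0.
  rewrite setIC; apply: dD; last exact: metric_ball_open.
  by exists x; exact: ballxx.
exists n => //; exists i => //; split => /=; first exact: ball_sym.
move: xi; rewrite !ballEmdist /= => xi.
rewrite (le_lt_trans (metric_triangle _ x _))// metric_sym.
move: ne xi; move: (_^-1)%R (mdist _ i) (mdist _ y) => a b c; lra.
Qed.

End metric_borel.

Lemma powR_le_powRV {R : realType} (a b c : R) :
  (0 < a)%R -> (0 <= b)%R -> (0 <= c)%R -> (b `^ a <= c)%R = (b <= c `^ a^-1)%R.
Proof.
move=> a0 b0 c0; apply/idP/idP => [bc|bc].
  rewrite -[leLHS](powRr1 b0) -(divff (lt0r_neq0 a0)) powRrM.
  by apply: ge0_ler_powR; rewrite ?nnegrE ?powR_ge0 ?invr_ge0 // ltW.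
rewrite -(powRr1 c0) -(mulVf (lt0r_neq0 a0)) powRrM.
by apply: ge0_ler_powR; rewrite ?nnegrE ?powR_ge0 // ltW.
Qed.

(** * Sets of pairs where one function dominates a power of the distance *)

Section ahlfors_regular.
Context {R : realType} (X : completeMetricType R).
Variables (nu : {sigma_finite_measure set (borelType X) -> \bar R}).
Variables (s Ca CA : R).
Hypotheses (sepX : separable X) (s0 : (0 < s)%R) (CA0 : (0 < CA)%R).
Hypothesis reg : ahlfors_regular nu s Ca CA.

Lemma ahlfors_closed_ball_ge (x : X) (r : R) : (0 <= r)%R ->
  (Ca * r `^ s)%:E <= nu [set y | mdist x y <= r]%R.
Proof.
rewrite le_eqVlt => /predU1P[<-|r0].
  (* Regularity concerns positive radii only; at radius 0 the bound is 0 because [s > 0]. *)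
  by rewrite powR0 ?gt_eqF// mulr0 measure_ge0.
have /andP[h _] := reg x _ r0; apply: (le_trans h).
apply: le_measure; rewrite ?inE.
- exact: measurable_metric_ball.
- exact: measurable_closed_mdist_ball.
- by move=> y; rewrite ballEmdist => /ltW.
Qed.

Lemma ahlfors_closed_ball_le (x : X) (r : R) : (0 <= r)%R ->
  nu [set y | mdist x y <= r]%R <= (CA * r `^ s)%:E.
Proof.
move=> r0; apply/lee_addgt0Pr => e e0.
(* the closed ball lies in the open ball whose Ahlfors bound is exactly
   [CA * r `^ s + e] *)
pose rho := ((r `^ s + e / CA) `^ s^-1)%R.
have rs0 : (0 < r `^ s + e / CA)%R by rewrite ltr_wpDl ?powR_ge0// divr_gt0.
have rhoE : (CA * rho `^ s = CA * r `^ s + e)%R.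
  rewrite /rho -powRrM mulVf ?gt_eqF// powRr1 ?ltW// mulrDr; congr (_ + _)%R.
  by rewrite mulrC divfK// gt_eqF.
have r_rho : (r < rho)%R.
  rewrite -[ltLHS](powRr1 r0) -(divff (lt0r_neq0 s0)) powRrM.
  by rewrite gt0_ltr_powR ?invr_gt0 ?nnegrE ?powR_ge0 ?ltW ?ltrDl ?divr_gt0.
have /andP[_ h] := reg x _ (le_lt_trans r0 r_rho).
rewrite -EFinD -rhoE; apply: (le_trans _ h); apply: le_measure; rewrite ?inE.
- exact: measurable_closed_mdist_ball.
- exact: measurable_metric_ball.
- by move=> y; rewrite ballEmdist /= => /le_lt_trans; apply.
Qed.

Variable p : R.
Hypothesis p0 : (0 < p)%R.

(** The denominator is cleared so that, for [h >= 0] and [s / p > 0], the diagonal belongs to the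
    set; a quotient would be 0 there. The sections are then full closed balls. *)
Definition fst_superlevel (h : borelType X -> R) (t : R) :
    set (borelType X * borelType X) :=
  [set z : borelType X * borelType X |
    t * mdist (z.1 : X) (z.2 : X) `^ (s / p) <= h z.1]%R.

Definition snd_superlevel (h : borelType X -> R) (t : R) :
    set (borelType X * borelType X) :=
  [set z : borelType X * borelType X |
    t * mdist (z.1 : X) (z.2 : X) `^ (s / p) <= h z.2]%R.

Lemma measurable_powR_mdist : measurable_fun
  [set: borelType X * borelType X]
  (fun z : borelType X * borelType X =>
    mdist (z.1 : X) (z.2 : X) `^ (s / p) : R)%R.
Proof.
exact: (measurableT_comp (measurable_powR (s / p)) (measurable_mdist X sepX)).
Qed.

Implicit Types (h : borelType X -> R) (t : R).

Lemma measurable_fst_superlevel h t : measurable_fun setT h ->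
  measurable (fst_superlevel h t).
Proof.
move=> mh; rewrite -[fst_superlevel h t]setTI.
apply: (@measurable_fun_le _ _ _ _
    (fun z : borelType X * borelType X =>
      t * mdist (z.1 : X) (z.2 : X) `^ (s / p))%R (fun z => h z.1)) => //.
  by apply: measurable_funM => //; exact: measurable_powR_mdist.
exact: measurableT_comp.
Qed.

Lemma snd_superlevelE h t :
  snd_superlevel h t = [set z | fst_superlevel h t (z.2, z.1)].
Proof. by apply/seteqP; split => z; rewrite /fst_superlevel /= metric_sym. Qed.

Lemma measurable_snd_superlevel h t : measurable_fun setT h ->
  measurable (snd_superlevel h t).
Proof.
move=> mh; rewrite -[snd_superlevel h t]setTI.
apply: (@measurable_fun_le _ _ _ _
    (fun z : borelType X * borelType X =>
      t * mdist (z.1 : X) (z.2 : X) `^ (s / p))%R (fun z => h z.2)) => //.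
  by apply: measurable_funM => //; exact: measurable_powR_mdist.
exact: measurableT_comp.
Qed.

Lemma measure_snd_superlevel h t : measurable_fun setT h ->
  (nu \x nu) (snd_superlevel h t) = (nu \x nu) (fst_superlevel h t).
Proof.
move=> mh; rewrite snd_superlevelE product_measure_swap//.
exact: measurable_fst_superlevel.
Qed.

Lemma xsection_fst_superlevel h t x : (0 < t)%R -> (0 <= h x)%R ->
  xsection (fst_superlevel h t) x =
  [set y | mdist x y <= (h x / t) `^ (p / s)]%R.
Proof.
move=> t0 hx0.
have E y : (t * mdist x y `^ (s / p) <= h x)%R =
    (mdist x y <= (h x / t) `^ (s / p)^-1)%R.
  rewrite mulrC -ler_pdivlMr// powR_le_powRV ?divr_gt0 ?mdist_ge0//.
  by rewrite divr_ge0// ltW.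
apply/seteqP; split => y; rewrite /xsection/= inE /fst_superlevel /=.
  by rewrite E invf_div.
by rewrite E invf_div.
Qed.

(** Raised to the power [s], the radius of a section becomes [t^-p a^p]: this is what turns the
    Ahlfors bounds into multiples of the integral of [h^p]. *)
Let powR_radius (a t : R) : (0 < t)%R -> (0 <= a)%R ->
  (((a / t) `^ (p / s)) `^ s = t `^ (- p) * a `^ p)%R.
Proof.
move=> t0 a0; rewrite -powRrM divfK ?gt_eqF// mulrC.
rewrite powRM ?invr_ge0 ?(ltW t0)//; congr (_ * _)%R.
by rewrite -powR_inv1 ?ltW// -powRrM mulN1r.
Qed.

Lemma measurable_powR_comp h : measurable_fun setT h ->
  measurable_fun setT (fun x => (h x `^ p)%:E).
Proof.
move=> mh; apply/measurable_EFinP.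
by apply: (measurableT_comp (measurable_powR p)).
Qed.

Let integral_scale (h : borelType X -> R) (c t : R) : (0 <= c)%R ->
  measurable_fun setT h ->
  \int[nu]_x (c * (t `^ (- p) * h x `^ p))%:E =
  (t `^ (- p))%:E * (c%:E * \int[nu]_x (h x `^ p)%:E).
Proof.
move=> c0 mh; rewrite muleA -EFinM -ge0_integralZl//.
- by apply: eq_integral => x _; rewrite -EFinM; congr (_%:E); ring.
- exact: measurable_powR_comp.
- by move=> x _; rewrite lee_fin powR_ge0.
- by rewrite lee_fin mulr_ge0 ?powR_ge0.
Qed.

Let powR_mulK t (x : \bar R) : (0 < t)%R ->
  (t `^ p)%:E * ((t `^ (- p))%:E * x) = x.
Proof.
by move=> t0; rewrite muleA -EFinM powRN mulfV ?mul1e// gt_eqF// powR_gt0.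
Qed.

Lemma measure_fst_superlevel_ge h t :
  (0 <= Ca)%R -> measurable_fun setT h -> (forall x, 0 <= h x)%R -> (0 < t)%R ->
  Ca%:E * \int[nu]_x (h x `^ p)%:E <=
  (t `^ p)%:E * (nu \x nu) (fst_superlevel h t).
Proof.
move=> Ca0 mh h0 t0; rewrite -[leLHS](powR_mulK t _ t0) -integral_scale//.
apply: lee_wpmul2l; first by rewrite lee_fin powR_ge0.
(* The product measure is the integral of the measures of the sections, so the comparison is made
   pointwise in [x]. *)
apply: ge0_le_integral => //=.
- by move=> x _; rewrite lee_fin !mulr_ge0 ?powR_ge0.
- apply/measurable_EFinP; do 2 apply: measurable_funM => //.
  by apply: (measurableT_comp (measurable_powR p)).
- by apply: measurable_fun_xsection; exact: measurable_fst_superlevel.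
- move=> x _; rewrite xsection_fst_superlevel// -powR_radius//.
  exact/ahlfors_closed_ball_ge/powR_ge0.
Qed.

Lemma measure_fst_superlevel_le h t :
  measurable_fun setT h -> (forall x, 0 <= h x)%R -> (0 < t)%R ->
  (t `^ p)%:E * (nu \x nu) (fst_superlevel h t) <=
  CA%:E * \int[nu]_x (h x `^ p)%:E.
Proof.
move=> mh h0 t0.
rewrite -[leRHS](powR_mulK t _ t0) -integral_scale ?(ltW CA0)//.
apply: lee_wpmul2l; first by rewrite lee_fin powR_ge0.
apply: ge0_le_integral => //=.
- by apply: measurable_fun_xsection; exact: measurable_fst_superlevel.
- apply/measurable_EFinP; do 2 apply: measurable_funM => //.
  by apply: (measurableT_comp (measurable_powR p)).
- move=> x _; rewrite xsection_fst_superlevel// -powR_radius//.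
  exact/ahlfors_closed_ball_le/powR_ge0.
Qed.

(** Let [k] be [h] cut to 0 where [h >= eta]. A pair of the intersection lies in a superlevel set of
    [k] as soon as one of its points has [h < eta]; otherwise it lies in the square of [{eta <= h}].
    The two mirror sets of [k] give the factor 2. *)
Lemma measure_superlevel_setI_le h t eta : measurable_fun setT h ->
  (forall x, 0 <= h x)%R -> (0 < t)%R ->
  (t `^ p)%:E * (nu \x nu) (fst_superlevel h t `&` snd_superlevel h t) <=
  (2 * CA)%:E * \int[nu]_x ((if h x < eta then h x else 0) `^ p)%:E +
  (t `^ p)%:E * (nu [set x | eta <= h x]%R * nu [set x | eta <= h x]%R).
Proof.
move=> mh h0 t0; pose k x := (if h x < eta then h x else 0)%R.
have mk : measurable_fun setT k.
  by apply: measurable_fun_ifT => //; exact: measurable_fun_ltr.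
have k0 x : (0 <= k x)%R by rewrite /k; case: ifP.
have mS : measurable [set x | eta <= h x]%R.
  rewrite -[X in measurable X]setTI; apply: measurable_fun_le => //.
have tp0 : (0 <= (t `^ p)%:E) by rewrite lee_fin powR_ge0.
have le_kt : (nu \x nu) (fst_superlevel h t `&` snd_superlevel h t) <=
    (nu \x nu) (fst_superlevel k t) + (nu \x nu) (snd_superlevel k t) +
    nu [set x | eta <= h x]%R * nu [set x | eta <= h x]%R.
  rewrite -product_measure1E//.
  have mfk := measurable_fst_superlevel _ t mk.
  have msk := measurable_snd_superlevel _ t mk.
  apply: (@le_trans _ _ ((nu \x nu)
      (fst_superlevel k t `|` snd_superlevel k t `|`
      [set x | eta <= h x]%R `*` [set x | eta <= h x]%R))).
    apply: le_measure; rewrite ?inE.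
    - apply: measurableI; [exact: measurable_fst_superlevel|].
      exact: measurable_snd_superlevel.
    - by apply: measurableU; [exact: measurableU|exact: measurableX].
    - move=> [x y]; rewrite /fst_superlevel /snd_superlevel /k /= => -[hx hy].
      have [xe|xe] := ltP (h x) eta; first by left; left.
      by have [ye|ye] := ltP (h y) eta; [left; right|right].
  apply: (le_trans (measureU2 _ _ _)); first exact: measurableU.
    exact: measurableX.
  by apply: leeD => //; exact: measureU2.
apply: (le_trans (lee_wpmul2l tp0 le_kt)).
have nn0 A : 0 <= (nu \x nu) A by exact: measure_ge0.
rewrite measure_snd_superlevel//.
rewrite (ge0_muleDr _ (adde_ge0 (nn0 _) (nn0 _)) (mule_ge0 _ _))//. 
apply: leeD => //; rewrite -mule2n -mule_natl muleCA EFinM -muleA lee_wpmul2l//.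
exact: measure_fst_superlevel_le.
Qed.

(** In the preceding bound [eta = 1/(n+1)] is fixed first, making the integral term at most [e / 2]
    for all [t]; the square of [{eta <= h}] has finite measure, so a small [t] then handles the
    other term. *)
Lemma measure_superlevel_setI_cvg0 h : measurable_fun setT h ->
  (forall x, 0 <= h x)%R -> \int[nu]_x (h x `^ p)%:E < +oo ->
  forall e : R, (0 < e)%R -> exists2 d : R, (0 < d)%R &
  forall t, (0 < t < d)%R ->
  (t `^ p)%:E * (nu \x nu) (fst_superlevel h t `&` snd_superlevel h t) <= e%:E.
Proof.
move=> mh h0 hfin e e0.
pose k (n : nat) x := (if h x < n.+1%:R^-1 then h x else 0)%R.
have mk n : measurable_fun setT (k n).
  by apply: measurable_fun_ifT => //; exact: measurable_fun_ltr.
have k0 n x : (0 <= k n x <= h x)%R.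
  by rewrite /k; case: ifP => //; rewrite lexx h0.
have kcvg : (\int[nu]_x (k n x `^ p)%:E) @[n --> \oo] --> 0.
  have /(_ _ _ _)[] := @dominated_convergence _ _ _ nu _ measurableT
    (fun n x => (k n x `^ p)%:E) (cst 0) (fun x => (h x `^ p)%:E).
  - by move=> n; exact: measurable_powR_comp.
  - exact: measurable_cst.
  (* At each point the truncations are eventually 0: at once if [h x = 0], and from [1/(n+1) <= h x]
     on otherwise. *)
  - apply: aeW => x _; apply: cvg_near_cst.
    have [hx0|hx0] := leP (h x) 0%R.
      apply: nearW => n; rewrite /k.
      have -> : h x = 0%R by apply/eqP; rewrite eq_le hx0 h0.
      by rewrite if_same powR0// gt_eqF.
    near=> n; rewrite /k ltNge; have -> : (n.+1%:R^-1 <= h x)%R.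
      by apply: ltW; near: n; exact: near_infty_natSinv_lt (PosNum hx0).
    by rewrite powR0// gt_eqF.
  - apply/integrableP; split; first exact: measurable_powR_comp.
    by under eq_integral do rewrite gee0_abs ?lee_fin ?powR_ge0//.
  - apply: aeW => x n _; rewrite gee0_abs ?lee_fin ?powR_ge0//.
    have /andP[? ?] := k0 n x.
    by apply: ge0_ler_powR; rewrite ?nnegrE// ltW.
  - by move=> _ _; rewrite integral_cst// mul0e.
have [n ne] : exists n, (2 * CA)%:E * \int[nu]_x (k n x `^ p)%:E <= (e / 2)%:E.
  have : \forall n \near \oo, \int[nu]_x (k n x `^ p)%:E <
      (e / 2 / (2 * CA))%:E.
    apply: (kcvg [set x | x < (e / 2 / (2 * CA))%:E]); apply: open_ereal_lt'.
    by rewrite lte_fin !divr_gt0// mulr_gt0.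
  move=> /filter_ex[n /ltW nle]; exists n.
  rewrite (le_trans (lee_wpmul2l _ nle)) ?lee_fin ?mulr_ge0 ?(ltW CA0)//.
  by rewrite mulrC divfK// gt_eqF// mulr_gt0.
pose S := [set x | n.+1%:R^-1 <= h x]%R.
have np0 : (0 < n.+1%:R^-1 `^ p :> R)%R by rewrite powR_gt0 ?invr_gt0.
have Sfin : nu S < +oo.
  have mhp := measurable_powR_comp _ mh.
  (* Markov's inequality for [h^p] at level [(n+1)^-p] bounds the measure of [S]. *)
  pose S' : set (borelType X) := [set: borelType X] `&`
    [set x | (n.+1%:R^-1 `^ p)%:E <= `|(h x `^ p)%:E|].
  have cheb : (n.+1%:R^-1 `^ p)%:E * nu S' <= \int[nu]_x `|(h x `^ p)%:E|.
    exact (le_integral_abse nu measurableT mhp np0).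
  have SE : nu S <= nu S'.
    apply: le_measure; rewrite ?inE.
    - rewrite -[X in measurable X]setTI; apply: measurable_fun_le => //.
    - by apply: emeasurable_fun_c_infty => //; exact: measurableT_comp.
    - move=> x; rewrite /S' /S /= => Sx; split => //=.
      rewrite lee_fin ger0_norm ?powR_ge0//.
      by apply: ge0_ler_powR; rewrite ?nnegrE ?invr_ge0// ltW.
  rewrite (le_lt_trans SE)// ltey; apply/eqP => Soo.
  move: cheb; rewrite Soo gt0_muley ?lte_fin// leye_eq => /eqP.
  under eq_integral do rewrite gee0_abs ?lee_fin ?powR_ge0//.
  by move=> hoo; rewrite hoo in hfin.
have SSfin : nu S * nu S \is a fin_num by rewrite fin_numM// ge0_fin_numE.
pose K := fine (nu S * nu S).
have K0 : (0 <= K)%R by rewrite fine_ge0// mule_ge0.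
have eK0 : (0 < e / 2 / (K + 1))%R by rewrite !divr_gt0// ltr_wpDl.
(* Chosen so that [t < d] gives [t^p K <= e / 2]; dividing by [K + 1] covers the case [K = 0]. *)
exists ((e / 2 / (K + 1)) `^ p^-1)%R; first exact: powR_gt0.
move=> t /andP[t0 td].
apply: (le_trans (measure_superlevel_setI_le _ _ n.+1%:R^-1%R mh h0 t0)).
rewrite [e]splitr EFinD; apply: leeD => //.
rewrite -/S -(fineK SSfin) -/K -EFinM lee_fin.
have tp : (t `^ p <= e / 2 / (K + 1))%R.
  by rewrite powR_le_powRV// ltW.
rewrite (@le_trans _ _ (e / 2 / (K + 1) * (K + 1))%R)//; last first.
  by rewrite divfK// gt_eqF// ltr_wpDl.
by rewrite ler_pM// ?powR_ge0// lerDl.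
Unshelve. all: by end_near.
Qed.

End ahlfors_regular.

(** Supplies a dilation factor near 1 whose effect on the constant [K] is at most [e]. The choice
    [c^p = (K + e)/(K + 2e)] works because [(K + e)^2 >= K (K + 2e)]; the ratio [K/(K + e)] would
    give [c = 0] when [K = 0]. *)
Lemma powR_contraction {R : realType} (p K e : R) :
  (0 < p)%R -> (0 <= K)%R -> (0 < e)%R ->
  exists2 c : R, (0 < c < 1)%R & (K <= (K + e) * c `^ p)%R.
Proof.
move=> p0 K0 e0; pose q := ((K + e) / (K + 2 * e))%R.
have d0 : (0 < K + 2 * e)%R by lra.
have q0 : (0 < q)%R by rewrite divr_gt0//; lra.
have q1 : (q < 1)%R by rewrite ltr_pdivrMr// mul1r; lra.
exists (q `^ p^-1)%R.
  rewrite powR_gt0//=; have -> : 1%R = (1 `^ p^-1)%R :> R by rewrite powR1.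
  by apply: gt0_ltr_powR; rewrite ?invr_gt0 ?nnegrE// ltW.
rewrite -powRrM mulVf ?gt_eqF// powRr1 ?(ltW q0)// /q mulrA ler_pdivlMr//.
by rewrite -subr_ge0; nra.
Qed.

(** * Superlevel sets of the difference quotient *)

Section diff_quot_superlevel.
Context {R : realType} (X : completeMetricType R).
Variables (nu : {sigma_finite_measure set (borelType X) -> \bar R}).
Variables (s Ca CA : R).
Hypotheses (sepX : separable X) (s0 : (0 < s)%R).
Hypotheses (Ca0 : (0 < Ca)%R) (CA0 : (0 < CA)%R).
Hypothesis reg : ahlfors_regular nu s Ca CA.
Variable p : R.
Hypothesis p0 : (0 < p)%R.
Variable u : borelType X -> R.
Hypothesis mes_u : measurable_fun setT u.

Let h x : R := `|u x|%R.
Let N := \int[nu]_x (h x `^ p)%:E.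
Hypothesis Nfin : N < +oo.

Let E (l : R) : set (borelType X * borelType X) :=
  diff_quot_superlevel u (s / p) l.
Let A (t : R) := fst_superlevel X s p h t.
Let B (t : R) := snd_superlevel X s p h t.
Let m : set (borelType X * borelType X) -> \bar R := nu \x nu.

Let mh : measurable_fun setT h.
Proof. exact: measurableT_comp. Qed.

Let h0 x : (0 <= h x)%R. Proof. exact: normr_ge0. Qed.

Let mA t : measurable (A t). Proof. exact: measurable_fst_superlevel. Qed.

Let mB t : measurable (B t). Proof. exact: measurable_snd_superlevel. Qed.

Let mBE t : m (B t) = m (A t). Proof. exact: measure_snd_superlevel. Qed.

Let m_ge0 S : 0 <= m S. Proof. exact: (measure_ge0 (nu \x nu)). Qed.

(** The diagonal is excluded because the quotient is 0 there and [l > 0]; elsewhere the denominator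
    is positive and can be cleared. *)
Lemma diff_quot_superlevelP (l : R) (x y : X) : (0 < l)%R ->
  E l (x, y) <->
  (0 < mdist x y)%R /\ (l * mdist x y `^ (s / p) <= `|u x - u y|)%R.
Proof.
move=> l0; rewrite /E /diff_quot_superlevel /=.
have [xy|] := ltP 0%R (mdist x y).
  by rewrite ler_pdivlMr ?powR_gt0//; split => [|[]].
rewrite le_eqVlt ltNge mdist_ge0 orbF => /eqP d0.
have -> : x = y by apply: mdist_positivity; rewrite d0.
by rewrite subrr normr0 mul0r leNgt l0; split => // -[].
Qed.

Lemma measurable_diff_quot_superlevel (l : R) : (0 < l)%R -> measurable (E l).
Proof.
move=> l0.
(* The diagonal is removed as the measurable set [{d <= 0}]. *)
have -> : E l = ([set: borelType X * borelType X] `&`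
    [set z : borelType X * borelType X |
      l * mdist (z.1 : X) (z.2 : X) `^ (s / p) <= `|u z.1 - u z.2| ]%R) `\`
    ([set: borelType X * borelType X] `&`
    [set z : borelType X * borelType X |
      mdist (z.1 : X) (z.2 : X) <= cst 0%R z]%R).
  apply/seteqP; split => -[x y]; rewrite diff_quot_superlevelP//=.
    by move=> [xy lxy]; split => //= -[_]; rewrite leNgt xy.
  by move=> [[_ lxy] /not_andP[//|/negP]]; rewrite -ltNge.
apply: measurableD.
  apply: (@measurable_fun_le _ _ _ _
    (fun z : borelType X * borelType X =>
      l * mdist (z.1 : X) (z.2 : X) `^ (s / p))%R
    (fun z => `|u z.1 - u z.2|%R)) => //.
    by apply: measurable_funM => //; exact: measurable_powR_mdist.
  apply: measurableT_comp => //.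
  by apply: measurable_funB; exact: measurableT_comp.
apply: (@measurable_fun_le _ _ _ _
  (fun z : borelType X * borelType X => mdist (z.1 : X) (z.2 : X))
  (cst 0%R)) => //.
exact: measurable_mdist.
Qed.

(* If [|u x|] and [|u y|] are both below [c v], where [v = l d(x,y)^(s/p)], then
   both exceed [(1 - c) v], since their sum is at least [v]. *)
Lemma diff_quot_superlevel_sub (l c : R) : (0 < l)%R -> (0 < c < 1)%R ->
  E l `<=` A (c * l) `|` B (c * l) `|` (A ((1 - c) * l) `&` B ((1 - c) * l)).
Proof.
move=> l0 /andP[c0 c1] [x y]; rewrite diff_quot_superlevelP// => -[d0].
rewrite /A /B /fst_superlevel /snd_superlevel /= -!mulrA => H.
have := le_trans H (ler_normB _ _); rewrite -!/(h _).
set v := (l * _)%R => le_v.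
have [|Ax] := leP (c * v)%R (h x); first by left; left.
have [|By] := leP (c * v)%R (h y); first by left; right.
by right; split; move: le_v Ax By; rewrite ?mulrBl ?mul1r; lra.
Qed.

Lemma diff_quot_superlevel_sub_half (l : R) : (0 < l)%R ->
  E l `<=` A (2^-1 * l) `|` B (2^-1 * l).
Proof.
move=> l0; have h2 : (0 < (2^-1 : R) < 1)%R by lra.
move=> z /(diff_quot_superlevel_sub l (2^-1)%R l0 h2)[//|[Az _]].
by left; move: Az; congr A; congr (_ * _)%R; lra.
Qed.

(** With [v = l d(x,y)^(s/p)], if one of [|u x|], [|u y|] is at least [(1 + e) v] and the other is
    below [e v], then [|u x - u y| > v]. *)
Lemma diff_quot_superlevel_sup (l e : R) : (0 < l)%R -> (0 < e)%R ->
  (A ((1 + e) * l) `\` B (e * l)) `|` (B ((1 + e) * l) `\` A (e * l)) `<=` E l.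
Proof.
move=> l0 e0 [x y].
rewrite /A /B /fst_superlevel /snd_superlevel /= -!mulrA => H.
rewrite diff_quot_superlevelP//.
split.
  (* On the diagonal the threshold is 0, so the pair would belong to the subtracted set. *)
  rewrite lt_neqAle mdist_ge0 andbT; apply/eqP => d0.
  case: H => -[_]; rewrite -d0 powR0 ?gt_eqF ?divr_gt0// !mulr0;
    by apply; exact: h0.
move: H; set v := (l * _)%R => H.
case: H => -[]; rewrite /h => H /negP; rewrite -ltNge => H'.
  rewrite (le_trans _ (lerB_dist _ _))//; move: H H'; rewrite mulrDl mul1r; lra.
rewrite distrC (le_trans _ (lerB_dist _ _))//.
move: H H'; rewrite mulrDl mul1r; lra.
Qed.


Let powR_scale (l c : R) (x : \bar R) : (0 < l)%R -> (0 < c)%R ->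
  (l `^ p)%:E * x = (c `^ (- p))%:E * (((c * l) `^ p)%:E * x).
Proof.
move=> l0 c0; rewrite muleA -EFinM powRM ?(ltW l0) ?(ltW c0)// mulrA powRN.
by rewrite mulVf ?mul1r// gt_eqF// powR_gt0.
Qed.

Let scaled_measure_le (l c : R) : (0 < l)%R -> (0 < c)%R ->
  (l `^ p)%:E * m (A (c * l)) <= (c `^ (- p) * CA)%:E * N.
Proof.
move=> l0 c0; rewrite (powR_scale l c _ l0 c0) EFinM -muleA.
apply: lee_wpmul2l; first by rewrite lee_fin powR_ge0.
by apply: measure_fst_superlevel_le => //; [exact: reg|exact: mulr_gt0].
Qed.

Let scaled_measure_ge (l c : R) : (0 < l)%R -> (0 < c)%R ->
  (c `^ (- p) * Ca)%:E * N <= (l `^ p)%:E * m (A (c * l)).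
Proof.
move=> l0 c0; rewrite (powR_scale l c _ l0 c0) EFinM -muleA.
apply: lee_wpmul2l; first by rewrite lee_fin powR_ge0.
by apply: measure_fst_superlevel_ge => //;
  [exact: reg|exact: ltW|exact: mulr_gt0].
Qed.

(** Lowering the level to [l / 2] costs a factor [2^p], and the two mirror sets a factor 2. *)
Lemma measure_diff_quot_superlevel_le_half (l : R) : (0 < l)%R ->
  (l `^ p)%:E * m (E l) <= (2 `^ (p + 1) * CA)%:E * N.
Proof.
move=> l0; have lp0 : 0 <= (l `^ p)%:E by rewrite lee_fin powR_ge0.
have h2 : (0 < 2^-1 :> R)%R by rewrite invr_gt0.
have EAB : m (E l) <= m (A (2^-1 * l)) + m (A (2^-1 * l)).
  rewrite -{2}mBE.
  apply: (@le_trans _ _ (m (A (2^-1 * l) `|` B (2^-1 * l)))).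
    apply: (le_measure (nu \x nu)); rewrite ?inE.
    - exact: measurable_diff_quot_superlevel.
    - exact: measurableU.
    - exact: diff_quot_superlevel_sub_half.
  exact: (measureU2 (nu \x nu)).
apply: (le_trans (lee_wpmul2l lp0 EAB)).
rewrite ge0_muleDr//.
apply: (le_trans (leeD (scaled_measure_le _ _ l0 h2)
    (scaled_measure_le _ _ l0 h2))).
rewrite -ge0_muleDl ?lee_fin ?mulr_ge0 ?powR_ge0 ?(ltW CA0)// -EFinD.
have -> : (2 `^ (p + 1) = 2 * 2^-1 `^ (- p) :> R)%R.
  rewrite powRD ?pnatr_eq0 ?implybT// powRr1// mulrC; congr (_ * _)%R.
  by rewrite -[2^-1%R]powR_inv1// -powRrM mulrNN mul1r.
have -> // : (2^-1 `^ (- p) * CA + 2^-1 `^ (- p) * CA =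
  2 * 2^-1 `^ (- p) * CA)%R by ring.
Qed.

(** The intersection is weighted by the power of its own level [(1 - c) l], the normalisation in
    which it tends to 0 with [l] for fixed [c]. *)
Lemma measure_diff_quot_superlevel_le (l c : R) : (0 < l)%R -> (0 < c < 1)%R ->
  (l `^ p)%:E * m (E l) <= (c `^ (- p) * (2 * CA))%:E * N +
  ((1 - c) `^ (- p))%:E *
    ((((1 - c) * l) `^ p)%:E * m (A ((1 - c) * l) `&` B ((1 - c) * l))).
Proof.
move=> l0 /[dup] c01 /andP[c0 c1].
have lp0 : 0 <= (l `^ p)%:E by rewrite lee_fin powR_ge0.
have EAB : m (E l) <= m (A (c * l)) + m (A (c * l)) +
    m (A ((1 - c) * l) `&` B ((1 - c) * l)).
  rewrite -{2}mBE.
  apply: (@le_trans _ _ (m (A (c * l) `|` B (c * l) `|`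
      (A ((1 - c) * l) `&` B ((1 - c) * l))))).
    apply: (le_measure (nu \x nu)); rewrite ?inE.
    - exact: measurable_diff_quot_superlevel.
    - by apply: measurableU; [exact: measurableU|exact: measurableI].
    - exact: diff_quot_superlevel_sub.
  apply: (le_trans (measureU2 (nu \x nu) _ _)); first exact: measurableU.
    exact: measurableI.
  by apply: leeD => //; exact: (measureU2 (nu \x nu)).
apply: (le_trans (lee_wpmul2l lp0 EAB)).
rewrite (ge0_muleDr _ (adde_ge0 (m_ge0 _) (m_ge0 _)) (m_ge0 _)).
rewrite (ge0_muleDr _ (m_ge0 _) (m_ge0 _)) -powR_scale ?subr_gt0//.
apply: leeD => //.
apply: (le_trans (leeD (scaled_measure_le _ _ l0 c0)
    (scaled_measure_le _ _ l0 c0))).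
rewrite -ge0_muleDl ?lee_fin ?mulr_ge0 ?powR_ge0 ?(ltW CA0)// -EFinD.
by rewrite [X in X%:E * _ <= _](_ : _ = c `^ (- p) * (2 * CA))%R//; ring.
Qed.

(** The two differences contained in [E l] are disjoint since [A ((1 + e) l)] lies in [A (e l)], so
    their measures add, whence the factor 2. Each loses at most the intersection at level [e l]; the
    losses stand on the right to avoid subtracting extended reals. *)
Lemma measure_diff_quot_superlevel_ge (l e : R) : (0 < l)%R -> (0 < e)%R ->
  ((1 + e) `^ (- p) * (2 * Ca))%:E * N <= (l `^ p)%:E * m (E l) +
  (2 * e `^ (- p))%:E *
    (((e * l) `^ p)%:E * m (A (e * l) `&` B (e * l))).
Proof.
move=> l0 e0; have lp0 : 0 <= (l `^ p)%:E by rewrite lee_fin powR_ge0.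
have e1 : (0 < 1 + e)%R by rewrite ltr_wpDl.
have dA : m (A ((1 + e) * l)) <=
    m (A ((1 + e) * l) `\` B (e * l)) + m (A (e * l) `&` B (e * l)).
  rewrite {1}/m (measureDI (nu \x nu) (mA _) (mB (e * l))) leeD2l//.
  apply: (le_measure (nu \x nu)); rewrite ?inE; [exact: measurableI..|].
  apply: setSI => -[x y]; rewrite /A /fst_superlevel /= => /(le_trans _); apply.
  by rewrite -!mulrA ler_wpM2r ?mulr_ge0 ?powR_ge0 ?(ltW l0)// lerDr.
have dB : m (B ((1 + e) * l)) <=
    m (B ((1 + e) * l) `\` A (e * l)) + m (A (e * l) `&` B (e * l)).
  rewrite {1}/m (measureDI (nu \x nu) (mB _) (mA (e * l))) leeD2l//.
  apply: (le_measure (nu \x nu)); rewrite ?inE; [exact: measurableI..|].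
  rewrite [X in _ `<=` X]setIC.
  apply: setSI => -[x y]; rewrite /B /snd_superlevel /= => /(le_trans _); apply.
  by rewrite -!mulrA ler_wpM2r ?mulr_ge0 ?powR_ge0 ?(ltW l0)// lerDr.
have dAB : m (A ((1 + e) * l) `\` B (e * l)) + m (B ((1 + e) * l) `\` A (e * l))
    <= m (E l).
  rewrite /m -(measureU (nu \x nu)).
  - apply: (le_measure (nu \x nu)); rewrite ?inE.
    + by apply: measurableU; exact: measurableD.
    + exact: measurable_diff_quot_superlevel.
    + exact: diff_quot_superlevel_sup.
  - exact: measurableD.
  - exact: measurableD.
  - apply/seteqP; split => // -[x y] [[Az _] [_ nAz]]; apply: nAz.
    move: Az; rewrite /A /fst_superlevel /= => /(le_trans _); apply.
    by rewrite -!mulrA ler_wpM2r ?mulr_ge0 ?powR_ge0 ?(ltW l0)// lerDr.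
have main : m (A ((1 + e) * l)) + m (A ((1 + e) * l)) <=
    m (E l) + (m (A (e * l) `&` B (e * l)) + m (A (e * l) `&` B (e * l))).
  rewrite -{2}mBE; apply: (le_trans (leeD dA dB)).
  by rewrite addeACA leeD2r.
have := lee_wpmul2l lp0 main.
rewrite (ge0_muleDr _ (m_ge0 _) (m_ge0 _)).
rewrite (ge0_muleDr _ (m_ge0 _) (adde_ge0 (m_ge0 _) (m_ge0 _))).
move=> main'; apply: (le_trans _ (le_trans main' _)).
  apply: (le_trans _ (leeD (scaled_measure_ge _ _ l0 e1)
    (scaled_measure_ge _ _ l0 e1))).
  rewrite -ge0_muleDl ?lee_fin ?mulr_ge0 ?powR_ge0 ?(ltW Ca0)// -EFinD.
  by rewrite [X in _ <= X%:E * _](_ : _ =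
    (1 + e) `^ (- p) * (2 * Ca))%R//; ring.
rewrite leeD2l// EFinM -muleA -powR_scale// ge0_muleDr//.
by rewrite -mule2n -mule_natl lexx.
Qed.

Let near_superlevel_setI (c e : R) : (0 < c)%R -> (0 < e)%R ->
  \forall l \near 0^'+,
    (((c * l) `^ p)%:E * m (A (c * l) `&` B (c * l)) <= e%:E).
Proof.
move=> c0 e0.
have [d d0 dP] := measure_superlevel_setI_cvg0 _ nu _ _ _ sepX s0 CA0 reg _ p0
  _ mh h0 Nfin _ e0.
near=> l; apply: dP; apply/andP; split; first by rewrite mulr_gt0.
rewrite mulrC -ltr_pdivlMr//; near: l.
by apply: nbhs_right_lt; rewrite divr_gt0.
Unshelve. all: by end_near.
Qed.

Let N_fineK : N = (fine N)%:E.
Proof.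
rewrite fineK// ge0_fin_numE// integral_ge0// => x _.
by rewrite lee_fin powR_ge0.
Qed.

Let fineN_ge0 : (0 <= fine N)%R.
Proof.
by rewrite fine_ge0// integral_ge0// => x _; rewrite lee_fin powR_ge0.
Qed.

(** Half of the error [e] pays for the factor [c^-p], with [c] fixed; the other half bounds the
    intersection for small [l]. *)
Lemma limf_esup_measure_diff_quot_superlevel :
  limf_esup (fun l => (l `^ p)%:E * m (E l)) 0^'+ <= (2 * CA)%:E * N.
Proof.
rewrite N_fineK; apply/lee_addgt0Pr => e e0; apply: limf_esup_le_near.
pose K := (2 * CA * fine N)%R.
have K0 : (0 <= K)%R by rewrite !mulr_ge0// ltW.
have e2 : (0 < e / 2)%R by rewrite divr_gt0.
have [c /[dup] c01 /andP[c0 c1] cK] := powR_contraction p K (e / 2)%R p0 K0 e2.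
have c1' : (0 < 1 - c)%R by rewrite subr_gt0.
have cp0 : (0 < c `^ p)%R by rewrite powR_gt0.
have q0 : (0 < (1 - c) `^ p)%R by rewrite powR_gt0.
have e3 : (0 < (1 - c) `^ p * (e / 2))%R by rewrite mulr_gt0.
near=> l; have l0 : (0 < l)%R by [].
apply: (le_trans (measure_diff_quot_superlevel_le _ _ l0 c01)).
rewrite [e]splitr EFinD addeA; apply: leeD.
  rewrite N_fineK -!EFinM -EFinD lee_fin powRN -mulrA mulrC ler_pdivrMr//.
have -> : (e / 2)%:E = ((1 - c) `^ (- p))%:E * ((1 - c) `^ p * (e / 2))%:E.
  by rewrite -EFinM mulrA powRN mulVf ?mul1r// gt_eqF.
apply: lee_wpmul2l; first by rewrite lee_fin powR_ge0.
by near: l; exact: near_superlevel_setI.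
Unshelve. all: by end_near.
Qed.

Lemma limf_einf_measure_diff_quot_superlevel :
  (2 * Ca)%:E * N <= limf_einf (fun l => (l `^ p)%:E * m (E l)) 0^'+.
Proof.
rewrite N_fineK; apply/lee_subgt0Pr => e e0; apply: limf_einf_ge_near.
pose K := (2 * Ca * fine N)%R.
have K0 : (0 <= K)%R by rewrite !mulr_ge0// ltW.
have e2 : (0 < e / 2)%R by rewrite divr_gt0.
have [c /andP[c0 c1] cK] := powR_contraction p K (e / 2)%R p0 K0 e2.
(* Chosen so that [(1 + d)^-p = c^p]. *)
pose d := (c^-1 - 1)%R.
have d0 : (0 < d)%R by rewrite subr_gt0 invf_gt1.
have dp : (0 < d `^ p)%R by rewrite powR_gt0.
have cp0 : (0 < c `^ p)%R by rewrite powR_gt0.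
(* Multiplied by the coefficient [2 d^-p] of the intersection, this tolerance is [e / 2]. *)
have e3 : (0 < d `^ p * (e / 2 / 2))%R by rewrite !mulr_gt0// divr_gt0.
near=> l; have l0 : (0 < l)%R by [].
rewrite leeBlDr//.
apply: (@le_trans _ _ ((c `^ p * (2 * Ca))%:E * N + (e / 2)%:E)).
  rewrite N_fineK -!EFinM -EFinD lee_fin -/K.
  rewrite -(mulrA (c `^ p)%R) -/K (mulrC (c `^ p)%R).
  (* Here [K <= (K + e/2) c^p <= K c^p + e/2], as [c^p <= 1]. *)
  rewrite (le_trans cK)// mulrDl lerD2l ler_piMr ?(ltW e2)//.
  by rewrite powR_le_powRV ?powR1 ?(ltW c1)// ltW.
have -> : (c `^ p = (1 + d) `^ (- p))%R.
  rewrite /d addrC subrK -[(c^-1)%R]powR_inv1 ?(ltW c0)// -powRrM.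
  by rewrite mulrNN mul1r.
rewrite [e in leRHS]splitr EFinD addeA leeD2r//.
apply: (le_trans (measure_diff_quot_superlevel_ge _ _ l0 d0)).
rewrite leeD2l//.
have -> : (e / 2)%:E = (2 * d `^ (- p))%:E * (d `^ p * (e / 2 / 2))%:E.
  rewrite -EFinM powRN; congr (_%:E); field.
  by rewrite gt_eqF.
apply: lee_wpmul2l; first by rewrite lee_fin mulr_ge0 ?powR_ge0.
by near: l; exact: near_superlevel_setI.
Unshelve. all: by end_near.
Qed.

End diff_quot_superlevel.

(* The product measure of the library is only a measure when its second factor
   carries a sigma-finite structure, so [nu] is given one through an alias. *)
Section sigma_finite_version.
Context {d} {T : measurableType d} {R : realType}.
Variable nu : {measure set T -> \bar R}.

Definition sigma_finite_version of sigma_finite [set: T] nu :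
  set T -> \bar R := nu.

Variable sf : sigma_finite [set: T] nu.

HB.instance Definition _ := Measure.copy (sigma_finite_version sf) nu.

HB.instance Definition _ :=
  Measure_isSigmaFinite.Build _ _ _ (sigma_finite_version sf) sf.

End sigma_finite_version.
Arguments sigma_finite_version {d T R nu}.

Lemma ahlfors_regular_sigma_finite {R : realType} (X : completeMetricType R)
    (nu : {measure set (borelType X) -> \bar R}) (s Ca CA : R) :
  ahlfors_regular nu s Ca CA -> sigma_finite [set: borelType X] nu.
Proof.
move=> reg; exists (fun n => ball (point : X) n.+1%:R).
  apply/esym; rewrite -subTset => x _ /=.
  have d0 := mdist_ge0 (point : X) x.
  exists (Num.truncn (mdist (point : X) x)) => //.
  by rewrite ballEmdist /=; apply: truncnS_gt.
move=> n; split; first exact: measurable_metric_ball.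
have /andP[_] := reg point n.+1%:R (ltr0Sn _ _).
by move=> /le_lt_trans; apply; rewrite ltry.
Qed.

Theorem theorem3p2 (R : realType) (X : completeMetricType R)
  (nu : {measure set (borelType X) -> \bar R}) (s Ca CA : R)
  (mms : metric_measure_space nu) (nu_infty : nu [set: X] = +oo)
  (s0 : (0 < s)%R) (Ca0 : (0 < Ca)%R) (CA0 : (0 < CA)%R)
  (reg : ahlfors_regular nu s Ca CA)
  (p : R) (p1 : (1 <= p)%R) (u : borelType X -> R) (uLp : u \in Lfun nu p%:E) :
  let normp := 'N[nu]_(p%:E)[EFin \o u] `^ p in
  let weakp := weak_Lp_pow (nu \x nu) p (diff_quot u (s / p)) in
  let f := fun l : R =>
    (l `^ p)%:E * (nu \x nu) (diff_quot_superlevel u (s / p) l) in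
  ((2 * Ca)%:E * normp <= weakp /\
   weakp <= (2 `^ (p + 1) * CA)%:E * normp) /\
  [/\ (2 * Ca)%:E * normp <= limf_einf f 0^'+,
      limf_einf f 0^'+ <= limf_esup f 0^'+ &
      limf_esup f 0^'+ <= (2 * CA)%:E * normp].
Proof.
move=> normp weakp f.
have [sepX _ _] := mms.
have p0 : (0 < p)%R by exact: lt_le_trans p1.
have mes_u : measurable_fun setT u := set_mem (sub_Lfun_mfun uLp).
have normpE : normp = \int[nu]_x (`|u x| `^ p)%:E.
  by rewrite /normp poweR_Lnorm// gt_eqF.
have Nfin : \int[nu]_x (`|u x| `^ p)%:E < +oo.
  rewrite -normpE; apply: poweR_lty.
  exact: (set_mem (sub_Lfun_finLfun uLp)).
pose nu' : {sigma_finite_measure set (borelType X) -> \bar R} :=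
  sigma_finite_version (ahlfors_regular_sigma_finite _ _ _ _ _ reg).
have reg' : ahlfors_regular nu' s Ca CA := reg.
(* The weak quantity and the limits are governed by the same function [f] of the level. *)
have weakpE : weakp = ereal_sup [set f l | l in [set l : R | (0 < l)%R]].
  rewrite /weakp /weak_Lp_pow; congr ereal_sup; apply: eq_imagel => l _.
  congr (_ * (nu \x nu) _); apply/seteqP.
  by split => z; rewrite /diff_quot /diff_quot_superlevel /= normrM normfV
    (ger0_norm (powR_ge0 _ _)).
have ge_inf : (2 * Ca)%:E * normp <= limf_einf f 0^'+.
  rewrite normpE.
  by apply: (limf_einf_measure_diff_quot_superlevel X nu' s Ca CA).
have inf_sup : limf_einf f 0^'+ <= limf_esup f 0^'+ by exact: limf_einf_le_esup.
split; last first.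
  split => //; rewrite normpE.
  by apply: (limf_esup_measure_diff_quot_superlevel X nu' s Ca CA).
rewrite weakpE; split.
  (* The supremum of [f] dominates its upper limit at 0, so the lower bound with constant [2 Ca]
     comes from small levels alone. *)
  apply: (le_trans ge_inf (le_trans inf_sup _)).
  apply: limf_esup_le_near; near=> l; apply: ereal_sup_ubound.
  by exists l => //=.
apply: ge_ereal_sup => _ [l l0 <-]; rewrite normpE.
by apply: (measure_diff_quot_superlevel_le_half X nu' s Ca CA).
Unshelve. all: by end_near.
Qed.
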